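(* Let $\phi\in\Gamma_0(\mathbb{R}^m)$ be Legendre and very strictly convex, let $\bar x\in\operatorname{int}(\operatorname{dom}\phi)$, let $\nabla^2\phi$ be locally Lipschitz at $\bar x$, and let $f:\mathbb{R}^m\to\overline{\mathbb{R}}$ be finite at $\bar x$. Then $f$ is prox-regular at $\bar x$ for $\bar v\in\partial f(\bar x)$ if and only if $f\circ\nabla\phi^*$ is prox-regular at $\nabla\phi(\bar x)$ for $\bar u=\nabla^2\phi^*(\nabla\phi(\bar x))\bar v\in\partial(f\circ\nabla\phi^* )(\nabla\phi(\bar x))$.
   Context: $\overline{\mathbb{R}}=\mathbb{R}\cup\{-\infty,\infty\}$; $\Gamma_0(\mathbb{R}^m)$ is the set of proper lsc convex functions $\mathbb{R}^m\to\overline{\mathbb{R}}$. $\phi\in\Gamma_0(\mathbb{R}^m)$ is Legendre if it is essentially smooth ($\operatorname{int}(\operatorname{dom}\phi)\neq\emptyset$, $\phi$ is differentiable on $\operatorname{int}(\operatorname{dom}\phi)$, and $\|\nabla\phi(x^\nu)\|\to\infty$ whenever $x^\nu\to x\in\operatorname{bdry}\operatorname{dom}\phi$) and essentially strictly convex (strictly convex on every convex subset of $\operatorname{dom}\partial\phi$). Then $\nabla\phi:\operatorname{int}(\operatorname{dom}\phi)\to\operatorname{int}(\operatorname{dom}\phi^* )$ is a bijection with inverse $\nabla\phi^*$ ($\phi^*$ the convex conjugate). Very strictly convex: $\phi$ is $\mathcal{C}^2$ on $\operatorname{int}(\operatorname{dom}\phi)\neq\emptyset$ with $\nabla^2\phi(x)$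 positive definite for all $x\in\operatorname{int}(\operatorname{dom}\phi)$. $f\circ\nabla\phi^*$ is defined on $\operatorname{int}(\operatorname{dom}\phi^* )$ (and taken as $+\infty$ elsewhere; only its behavior near $\nabla\phi(\bar x)$ matters). $\partial$ is the limiting (Mordukhovich) subdifferential. $h$ is locally lsc at $\bar x$ (where $h$ is finite) if there is $\epsilon>0$ such that all sets $\{x:\|x-\bar x\|\le\epsilon,\ h(x)\le\alpha\}$ with $\alpha\le h(\bar x)+\epsilon$ are closed. $h$ is (classically) prox-regular at $\bar x$ for $\bar v$ if $h$ is finite and locally lsc at $\bar x$, $\bar v\in\partial h(\bar x)$, and there exist $\epsilon>0$, $r\ge0$ such that for all $\|x'-\bar x\|<\epsilon$, $\|x-\bar x\|<\epsilon$: $h(x')\ge h(x)+\langle v,x'-x\rangle-\frac r2\|x'-x\|^2$ whenever $h(x)-h(\bar x)<\epsilon$, $v\in\partial h(x)$, $\|v-\bar v\|<\epsilon$. *)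

(* Defs.v *)
From mathcomp Require Import all_boot all_order all_algebra.
From mathcomp Require Import all_classical all_reals all_analysis.

Set Implicit Arguments.
Unset Strict Implicit.
Unset Printing Implicit Defensive.

Import Order.TTheory GRing.Theory Num.Theory.
Import numFieldNormedType.Exports.

Local Open Scope classical_set_scope.
Local Open Scope ring_scope.

(* Points of R^m are row vectors. The library's norms on matrices are sup    *)
(* norms: they are used only for topology, differentiability and Lipschitz    *)
(* continuity, none of which depends on the choice of a norm. Wherever a norm *)
(* occurs in a formula it is the Euclidean one, enorm.                        *)
Definition dotv (R : realType) (m : nat) (x y : 'rV[R]_m) : R :=
  \sum_(i < m) x 0 i * y 0 i.

Definition enorm (R : realType) (m : nat) (x : 'rV[R]_m) : R :=
  Num.sqrt (dotv x x).

Section extended_real_valued.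
Variables (R : realType) (m : nat).
Implicit Types (f phi : 'rV[R]_m -> \bar R) (x v : 'rV[R]_m).

Definition dom f : set 'rV[R]_m := [set x | (f x < +oo)%E].

Definition bdry (A : set 'rV[R]_m) : set 'rV[R]_m := closure A `\` A°.

Definition proper f : Prop :=
  dom f !=set0 /\ forall x, f x != -oo%E.

(* For a proper f the right-hand side is never of the form +oo - oo. *)
Definition econvex f : Prop :=
  forall (x y : 'rV[R]_m) (t : R), 0 < t < 1 ->
    (f (t *: x + (1 - t) *: y)%R <= t%:E * f x + (1 - t)%R%:E * f y)%E.

Definition Gamma0 f : Prop :=
  [/\ proper f, lower_semicontinuous f & econvex f].

Definition conjugate f v : \bar R :=
  ereal_sup (range (fun x => (dotv v x)%:E - f x)%E).

(* f is only differentiated at interior points of its domain, near which fine *)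
(* does not change its values when f is proper.                               *)
Definition grad f x : 'rV[R]_m :=
  \row_(i < m) 'D_(delta_mx 0 i) (fine \o f : 'rV[R]_m -> R) x.

(* The library's Jacobian acts on row vectors from the right, so that the     *)
(* derivative of the gradient at x in the direction v is v *m hess f x.       *)
Definition hess f x : 'M[R]_m := 'J (grad f) x.

Definition C2_on f (U : set 'rV[R]_m) : Prop :=
  forall x, U x ->
    [/\ differentiable (fine \o f : 'rV[R]_m -> R) x,
        differentiable (grad f) x
      & {for x, continuous (hess f)}].

Definition regular_subdiff f x : set 'rV[R]_m :=
  [set v | f x \is a fin_num /\
    forall e : R, 0 < e -> \forall y \near x,
      (f x + (dotv v (y - x) - e * enorm (y - x))%R%:E <= f y)%E].

Definition limiting_subdiff f x : set 'rV[R]_m :=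
  [set v | f x \is a fin_num /\
    exists (xs vs : nat -> 'rV[R]_m),
      [/\ xs n @[n --> \oo] --> x,
          f (xs n) @[n --> \oo] --> f x,
          forall n, regular_subdiff f (xs n) (vs n)
        & vs n @[n --> \oo] --> v]].

Definition dom_subdiff f : set 'rV[R]_m :=
  [set x | limiting_subdiff f x !=set0].

Definition essentially_smooth phi : Prop :=
  [/\ (dom phi)° !=set0,
      forall x, (dom phi)° x ->
        differentiable (fine \o phi : 'rV[R]_m -> R) x
    & forall (x : 'rV[R]_m) (xs : nat -> 'rV[R]_m),
        bdry (dom phi) x -> (forall n, (dom phi)° (xs n)) ->
        xs n @[n --> \oo] --> x ->
        enorm (grad phi (xs n)) @[n --> \oo] --> +oo].

Definition strictly_convex_on (C : set 'rV[R]_m) phi : Prop :=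
  forall (x y : 'rV[R]_m) (t : R), C x -> C y -> x != y -> 0 < t < 1 ->
    (phi (t *: x + (1 - t) *: y)%R < t%:E * phi x + (1 - t)%R%:E * phi y)%E.

Definition essentially_strictly_convex phi : Prop :=
  forall C : set 'rV[R]_m,
    convex_set (C : set (convex_lmodType 'rV[R]_m)) ->
    C `<=` dom_subdiff phi -> strictly_convex_on C phi.

Definition Legendre phi : Prop :=
  essentially_smooth phi /\ essentially_strictly_convex phi.

Definition very_strictly_convex phi : Prop :=
  [/\ (dom phi)° !=set0,
      C2_on phi (dom phi)°
    & forall x w, (dom phi)° x -> w != 0 -> 0 < dotv (w *m hess phi x) w].

Definition hess_locally_lipschitz_at phi x : Prop :=
  exists2 A, nbhs x A & [lipschitz hess phi y | y in A].

Definition comp_grad_conjugate f phi : 'rV[R]_m -> \bar R :=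
  fun u => if u \in ((dom (conjugate phi))° : set 'rV[R]_m)
           then f (grad (conjugate phi) u) else +oo%E.

Definition locally_lsc f x : Prop :=
  f x \is a fin_num /\
  exists2 e : R, 0 < e & forall a : \bar R, (a <= f x + e%:E)%E ->
    closed [set y | enorm (y - x) <= e /\ (f y <= a)%E].

Definition prox_regular f (xbar vbar : 'rV[R]_m) : Prop :=
  [/\ f xbar \is a fin_num,
      locally_lsc f xbar,
      limiting_subdiff f xbar vbar
    & exists e r : R, [/\ 0 < e, 0 <= r &
        forall x' x v, enorm (x' - xbar) < e -> enorm (x - xbar) < e ->
          (f x - f xbar < e%:E)%E -> limiting_subdiff f x v ->
          enorm (v - vbar) < e ->
          (f x + (dotv v (x' - x) - r / 2 * enorm (x' - x) ^+ 2)%R%:E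
             <= f x')%E]].

End extended_real_valued.

(* Main.v *)
Require Import Defs.
From mathcomp Require Import all_boot all_order all_algebra.
From mathcomp Require Import all_classical all_reals all_analysis.
From mathcomp Require Import ring lra.
Set Implicit Arguments.
Unset Strict Implicit.
Unset Printing Implicit Defensive.
Import Order.TTheory GRing.Theory Num.Theory.
Import numFieldNormedType.Exports.
Local Open Scope classical_set_scope.
Local Open Scope ring_scope.

(** Near ubar = grad phi xbar the map g = grad (conjugate phi) is a C^1
diffeomorphism with Lipschitz derivative, whose inverse near xbar is grad phi,
and prox-regularity is invariant under such a change of variables.

For the invariance ([prox_regular_comp]), let h = f o g and let J be the
Jacobian of g, acting on row vectors from the right. A first-order expansion of
g shows that v in the subdifferential of f at g u yields v *m (J u)^T in that of
h at u, first for regular and then for limiting subgradients. Substituting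
x' = g u', x = g u in the prox-regularity inequality of f, the remainder
g u' - g u - (u' - u) *m J u is O(|u' - u|^2) because J is Lipschitz, and v
stays bounded, so that the pairing of v with the remainder is absorbed by
enlarging r. The relation between g and its inverse being symmetric, the same
lemma applied to the inverse gives the converse implication.

It remains to see that g is such a diffeomorphism ([grad_diffeo]). On a ball
around xbar the Hessian of phi is Lipschitz and uniformly positive definite, so
grad phi is Lipschitz, strongly monotone, and has a quadratic remainder. It is
onto a neighbourhood of ubar: for u close to ubar the minimiser of phi - <., u>
over a smaller closed ball is an interior point, where the gradient of phi is u
([grad_onto]). By convexity the conjugate of phi has the value <u, x> - phi x
at u = grad phi x; comparing these values at two nearby points identifies x as
the gradient of the conjugate at u ([conjugate_is_derive]). The estimates on
grad phi pass to its inverse ([C11_inverse]), whose Jacobian at ubar is the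
inverse of the Hessian of phi at xbar.

Subgradients are pulled back by the transposed Jacobian, while the theorem
multiplies vbar by the Hessian of the conjugate itself; the two agree because
Hessians are symmetric ([hess_sym]).

All estimates are made in the sup norm, which differs from the Euclidean norm
by at most the factor N = m + 1. *)

(** * Inner product, Euclidean norm and sup norm *)

Section euclidean.
Variables (R : realType) (m : nat).
Implicit Types x y z v w : 'rV[R]_m.

Lemma dotvE x y : dotv x y = (x *m y^T) 0 0.
Proof. by rewrite mxE; apply: eq_bigr => i _; rewrite mxE. Qed.

Lemma dotvC x y : dotv x y = dotv y x.
Proof. by apply: eq_bigr => i _; rewrite mulrC. Qed.

Lemma dotvDl x y z : dotv (x + y) z = dotv x z + dotv y z.
Proof. by rewrite !dotvE mulmxDl mxE. Qed.

Lemma dotvZl a x y : dotv (a *: x) y = a * dotv x y.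
Proof. by rewrite !dotvE -scalemxAl mxE. Qed.

Lemma dotvBl x y z : dotv (x - y) z = dotv x z - dotv y z.
Proof. by rewrite dotvDl -scaleN1r dotvZl mulN1r. Qed.

Lemma dotvZr a x y : dotv x (a *: y) = a * dotv x y.
Proof. by rewrite dotvC dotvZl dotvC. Qed.

Lemma dotvBr x y z : dotv x (y - z) = dotv x y - dotv x z.
Proof. by rewrite dotvC dotvBl !(dotvC x). Qed.

Lemma dotv_mulmx v x (A : 'M[R]_m) : dotv (v *m A) x = dotv v (x *m A^T).
Proof. by rewrite !dotvE trmx_mul trmxK mulmxA. Qed.

Lemma dotv_delta x i : dotv x (delta_mx 0 i) = x 0 i.
Proof.
rewrite /dotv (bigD1 i)//= big1 ?mxE ?eqxx ?mulr1 ?addr0// => j ji.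
by rewrite mxE (negbTE ji) andbF mulr0.
Qed.

Lemma dotv_inj x y : (forall w, dotv x w = dotv y w) -> x = y.
Proof. by move=> xy; apply/rowP => i; rewrite -!dotv_delta. Qed.

Lemma le_mx_norm p q (A : 'M[R]_(p, q)) i j : `|A i j| <= `|A|.
Proof.
rewrite [leRHS]mx_normrE; apply/bigmax_geP; right => /=.
by exists (i, j).
Qed.

Lemma mx_norm_le p q (A : 'M[R]_(p, q)) c :
  0 <= c -> (forall i j, `|A i j| <= c) -> `|A| <= c.
Proof.
move=> c0 Ac; rewrite [leLHS]mx_normrE.
by apply/bigmax_leP; split => // -[i j] _ /=; exact: Ac.
Qed.

Lemma norm_trmx p q (A : 'M[R]_(p, q)) : `|A^T| = `|A|.
Proof.
apply/eqP; rewrite eq_le !mx_norm_le// => i j; rewrite ?mxE ?le_mx_norm//.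
by have := le_mx_norm A^T j i; rewrite mxE.
Qed.

(** The factor is n + 1, rather than n, so that it is also positive in
dimension 0 and can be divided by. *)
Lemma norm_mulmx p n q (A : 'M[R]_(p, n)) (B : 'M[R]_(n, q)) :
  `|A *m B| <= n.+1%:R * (`|A| * `|B|).
Proof.
have AB0 : 0 <= `|A| * `|B| by rewrite mulr_ge0.
apply: mx_norm_le => [|i j]; first by rewrite mulr_ge0.
rewrite mxE; apply: (le_trans (ler_norm_sum _ _ _)).
apply: (@le_trans _ _ (\sum_(k < n) `|A| * `|B|)).
  by apply: ler_sum => k _; rewrite normrM ler_pM ?le_mx_norm.
rewrite sumr_const card_ord -[leLHS]mulr_natl ler_wpM2r// ler_nat.
exact: leqnSn.
Qed.

Lemma norm_dotv x y : `|dotv x y| <= m.+1%:R * (`|x| * `|y|).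
Proof.
by rewrite dotvE -(norm_trmx y); apply: le_trans (norm_mulmx _ _);
  exact: le_mx_norm.
Qed.

Lemma dotvv_ge0 x : 0 <= dotv x x.
Proof. by apply: sumr_ge0 => i _; rewrite -expr2 sqr_ge0. Qed.

Lemma enorm_ge0 x : 0 <= enorm x. Proof. exact: sqrtr_ge0. Qed.

Lemma sqr_enorm x : enorm x ^+ 2 = dotv x x.
Proof. by rewrite sqr_sqrtr// dotvv_ge0. Qed.

Lemma norm_le_enorm x : `|x| <= enorm x.
Proof.
apply: mx_norm_le => [|i j]; first exact: enorm_ge0.
rewrite -sqrtr_sqr ler_wsqrtr// /dotv (ord1 i) (bigD1 j)//= expr2 lerDl.
by apply: sumr_ge0 => k _; rewrite -expr2 sqr_ge0.
Qed.

Lemma enorm_le_norm x : enorm x <= m.+1%:R * `|x|.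
Proof.
rewrite -(ler_pXn2r (ltn0Sn 1)) ?nnegrE ?enorm_ge0 ?mulr_ge0//.
rewrite sqr_enorm exprMn (le_trans (ler_norm _))//.
rewrite (le_trans (norm_dotv _ _))// -expr2 ler_wpM2r ?sqr_ge0//.
by rewrite expr2 ler_peMr// ler1n.
Qed.

Lemma norm_sqr_le_dotv x : `|x| ^+ 2 <= dotv x x.
Proof.
by rewrite -sqr_enorm ler_pXn2r ?nnegrE ?enorm_ge0// norm_le_enorm.
Qed.

Lemma cvg_dotv (T : Type) (F : set_system T) (f g : T -> 'rV[R]_m) x y :
  Filter F -> f @ F --> x -> g @ F --> y ->
  (fun t => dotv (f t) (g t)) @ F --> dotv x y.
Proof.
move=> FF fx gy; apply: cvg_big => [|i _]; first exact: add_continuous.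
have coord h z : h @ F --> z -> (fun t => (h t : 'rV[R]_m) 0 i) @ F --> z 0 i.
  move=> hz; apply: (cvg_comp h (fun M => M 0 i) hz).
  exact: coord_continuous.
by apply: cvgM; exact: coord.
Qed.

Lemma continuous_enorm : continuous (@enorm R m).
Proof.
move=> y; apply: (@continuous_comp _ _ _ (fun y => dotv y y) Num.sqrt).
  exact: (@cvg_dotv _ (nbhs y) id id).
exact: sqrt_continuous.
Qed.

Lemma closed_enorm_ball x r : closed [set y | enorm (y - x) <= r].
Proof.
have cx : continuous (fun y => enorm (y - x)).
  move=> y; apply: (@continuous_comp _ _ _ (fun y => y - x) (@enorm R m)).
    exact: (@cvgB _ _ _ (nbhs y) _ id (cst x) _ _ cvg_id (cvg_cst _)).
  exact: continuous_enorm.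
by apply: (continuous_closedP _).1 cx [set s | s <= r] _; exact: closed_le.
Qed.

End euclidean.

(** * Limits and Lipschitz maps *)

Section limits.
Variable R : realType.

Lemma dist_lt_half (p q p' q' e : R) :
  `|p - p'| < e / 2 -> `|q - q'| < e / 2 -> p' = q' -> `|p - q| < e.
Proof.
move=> pp' qq' E; rewrite -E distrC in qq'.
rewrite [e]splitr (le_lt_trans _ (ltrD pp' qq'))//.
by rewrite (le_trans _ (ler_normD _ _))// addrA subrK.
Qed.

Lemma cvg_trmx (T : Type) (F : set_system T) p q
    (A : T -> 'M[R]_(p, q)) (B : 'M[R]_(p, q)) :
  Filter F -> A @ F --> B -> (fun t => (A t)^T) @ F --> B^T.
Proof.
move=> FF /cvgrPdist_lt AB; apply/cvgrPdist_lt => e /AB.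
by apply: filterS => t; rewrite -linearB/= norm_trmx.
Qed.

Lemma cvg_mulmx (T : Type) (F : set_system T) p n q
    (A : T -> 'M[R]_(p, n)) (B : T -> 'M[R]_(n, q))
    (A0 : 'M[R]_(p, n)) (B0 : 'M[R]_(n, q)) :
  Filter F -> A @ F --> A0 -> B @ F --> B0 ->
  (fun t => A t *m B t) @ F --> A0 *m B0.
Proof.
move=> FF /cvgrPdist_lt cA /cvgrPdist_lt cB; apply/cvgrPdist_lt => e e0.
have K0 : 0 < n.+1%:R * (`|A0| + `|B0| + 1) :> R.
  by rewrite mulr_gt0// ltr_wpDl// addr_ge0.
pose d := Num.min 1 (e / (n.+1%:R * (`|A0| + `|B0| + 1))).
have d0 : 0 < d by rewrite lt_min ltr01 divr_gt0.
have de : n.+1%:R * (d * (`|A0| + `|B0| + 1)) <= e.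
  by rewrite mulrCA -ler_pdivlMr// ge_min lexx orbT.
have d1 : d <= 1 by rewrite ge_min lexx.
apply: filterS2 (cA d d0) (cB d d0) => t At Bt.
have -> : A0 *m B0 - A t *m B t = A0 *m (B0 - B t) + (A0 - A t) *m B t.
  by rewrite mulmxBr mulmxBl addrA subrK.
rewrite (le_lt_trans (ler_normD _ _))//; apply: lt_le_trans de.
have Bt1 : `|B t| < `|B0| + 1.
  rewrite -ltrBlDl; apply: le_lt_trans (lt_le_trans Bt d1).
  by rewrite distrC lerB_dist.
rewrite (le_lt_trans (lerD (norm_mulmx _ _) (norm_mulmx _ _)))// -mulrDr.
rewrite ltr_pM2l// -addrA mulrDr ler_ltD//.
  by rewrite mulrC ler_wpM2r// ltW.
by apply: ltr_pM.
Qed.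

Lemma near_dist_lt (U : normedModType R) (u : U) e :
  0 < e -> \forall u' \near u, `|u - u'| < e.
Proof. by move=> e0; apply/nbhs_normP; exists e. Qed.

Lemma near_ex_dist (U : normedModType R) (u : U) (P : set U) :
  nbhs u P -> exists2 r : R, 0 < r & forall u', `|u - u'| < r -> P u'.
Proof. by move=> /nbhs_ballP[r r0]; rewrite -ball_normE => rP; exists r. Qed.

Lemma lipschitz_cvg (U W : normedModType R) (g : U -> W) (V : set U) C u :
  open V -> V u -> (forall u', V u' -> `|g u' - g u| <= C * `|u' - u|) ->
  g @ u --> g u.
Proof.
move=> oV Vu gC; apply/cvgrPdist_lt => e e0.
have C0 : 0 < `|C| + 1 by rewrite ltr_wpDl.
have VN : \forall u' \near u, V u' by exact: open_nbhs_nbhs.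
have UN : \forall u' \near u, `|u - u'| < e / (`|C| + 1).
  by apply: near_dist_lt; exact: divr_gt0.
apply: filterS2 VN UN => u' /gC gu' uu'; rewrite distrC (le_lt_trans gu')//.
rewrite ltr_pdivlMr// in uu'; apply: le_lt_trans uu'; rewrite distrC mulrC.
by rewrite ler_wpM2l// (le_trans (ler_norm _))// lerDl.
Qed.

End limits.

(** * Change of variables in subdifferentials and prox-regularity *)

Section change_of_variables.
Variables (R : realType) (m : nat).
Implicit Types (u v w x : 'rV[R]_m) (f h : 'rV[R]_m -> \bar R).
Local Notation N := (m.+1%:R : R).

(** Quantitative form of: g is differentiable on V with Jacobian J, and J is
bounded and Lipschitz. The Taylor estimate pins J down on an open V (see
[C11_jacobian]) without mentioning the differential of g. *)
Definition C11_map (g : 'rV[R]_m -> 'rV[R]_m) (J : 'rV[R]_m -> 'M[R]_m)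
    (V : set 'rV[R]_m) (C : R) : Prop :=
  forall u u', V u -> V u' ->
    [/\ `|J u| <= C, `|J u' - J u| <= C * `|u' - u|,
        `|g u' - g u| <= C * `|u' - u|
      & `|g u' - g u - (u' - u) *m J u| <= C * `|u' - u| ^+ 2].

(** A pair of mutually inverse maps of the above kind, g from V onto W and G
from W onto V. The data of both directions is kept explicit so that exchanging
the two is immediate. *)
Definition C11_diffeo g J V G K W : Prop :=
  [/\ open V /\ open W,
      forall u, V u -> [/\ W (g u), G (g u) = u & J u *m K (g u) = 1%:M],
      forall x, W x -> V (G x) /\ g (G x) = x,
      exists C, C11_map g J V C
    & exists C, C11_map G K W C].

Lemma C11_diffeo_sym g J V G K W :
  C11_diffeo g J V G K W -> C11_diffeo G K W g J V.
Proof.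
move=> [[oV oW] gV GW Jg KG]; split=> // [x /GW[VGx gGx]|u /gV[]//].
by have [_ _] := gV _ VGx; rewrite gGx => /mulmx1C.
Qed.

Section fixed_map.
Variables (g : 'rV[R]_m -> 'rV[R]_m) (J : 'rV[R]_m -> 'M[R]_m).
Variables (V : set 'rV[R]_m) (C : R).
Hypotheses (oV : open V) (gC : C11_map g J V C).

Lemma C11_ge0 u : V u -> 0 <= C.
Proof. by move=> Vu; have [+ _ _ _] := gC Vu Vu; apply: le_trans. Qed.

Lemma C11_cvg u : V u -> g @ u --> g u.
Proof.
move=> Vu; apply: (lipschitz_cvg (C := C) oV Vu) => u' Vu'.
by have [] := gC Vu Vu'.
Qed.

Lemma C11_jacobian_cvg u : V u -> J @ u --> J u.
Proof.
move=> Vu; apply: (lipschitz_cvg (C := C) oV Vu) => u' Vu'.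
by have [] := gC Vu Vu'.
Qed.

(** First-order expansion of <v, g>: the covector v is pulled back by the
transposed Jacobian, with a quadratic remainder. *)
Lemma C11_expansion v u u' : V u -> V u' ->
  `|dotv v (g u' - g u) - dotv (v *m (J u)^T) (u' - u)|
    <= N * (`|v| * (C * `|u' - u| ^+ 2)).
Proof.
move=> Vu Vu'; rewrite dotv_mulmx trmxK -dotvBr (le_trans (norm_dotv _ _))//.
by rewrite ler_wpM2l// ler_wpM2l//; have [] := gC Vu Vu'.
Qed.

Lemma C11_enorm u u' : V u -> V u' ->
  enorm (g u' - g u) <= N * C * `|u' - u|.
Proof.
move=> Vu Vu'; rewrite (le_trans (enorm_le_norm _))// -mulrA ler_wpM2l//.
by have [] := gC Vu Vu'.
Qed.

(** Continuity of g on Euclidean closed balls, the form in which neighbourhoods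
enter the definitions of local lower semicontinuity and prox-regularity. *)
Lemma C11_ball u e : V u -> 0 < e ->
  exists2 r, 0 < r <= e & forall u', enorm (u' - u) <= r ->
    V u' /\ enorm (g u' - g u) <= e.
Proof.
move=> Vu e0; have /nbhs_ballP[d /= d0 dV] : nbhs u V by exact: open_nbhs_nbhs.
have C0 := C11_ge0 Vu.
have K0 : 0 < N * C + 1 by rewrite ltr_wpDl// mulr_ge0.
exists (Num.min (d / 2) (Num.min e (e / (N * C + 1)))).
  by rewrite !lt_min divr_gt0// e0 divr_gt0// ge_min ge_min lexx orbT.
move=> u'; rewrite !le_min => /and3P[ud _ ue].
have uu' := norm_le_enorm (u' - u).
have Vu' : V u'.
  apply: dV; rewrite -ball_normE/= distrC (le_lt_trans uu')//.
  by rewrite (le_lt_trans ud)// ltr_pdivrMr// ltr_pMr// ltr1n.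
split=> //; rewrite (le_trans (C11_enorm Vu Vu'))//.
rewrite ler_pdivlMr// in ue; apply: le_trans ue; rewrite [leRHS]mulrC.
by apply: ler_pM => //; [exact: mulr_ge0|rewrite lerDl].
Qed.

(** The error at u' consists of the quadratic remainder of g, which is small
compared with |u' - u|, and of the error term of f at g u', which is controlled
since g is Lipschitz. *)
Lemma regular_subdiff_comp f h u v : V u ->
  (forall u', V u' -> h u' = f (g u')) ->
  regular_subdiff f (g u) v -> regular_subdiff h u (v *m (J u)^T).
Proof.
move=> Vu hE [fin fv]; split; first by rewrite hE.
move=> e e0; have C0 := C11_ge0 Vu.
(* One half of e pays for the error term of f, the other half for the
   remainder of g. *)
have K0 : 0 < 2 * (N * C + 1) by rewrite mulr_gt0// ltr_wpDl// mulr_ge0.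
have /C11_cvg := Vu; move=> /(_ _ (fv _ (divr_gt0 e0 K0)))/= fvu.
have VN : \forall u' \near u, V u' by exact: open_nbhs_nbhs.
have L0 : 0 < 2 * (N * (`|v| * C) + 1).
  by rewrite mulr_gt0// ltr_wpDl// !mulr_ge0.
have UN : \forall u' \near u, `|u - u'| < e / (2 * (N * (`|v| * C) + 1)).
  by apply: near_dist_lt; exact: divr_gt0.
near=> u'.
have Vu' : V u' by near: u'.
have ud : `|u - u'| < e / (2 * (N * (`|v| * C) + 1)) by near: u'.
rewrite !hE//; apply: (@le_trans _ _ (f (g u) + (dotv v (g u' - g u) -
    e / (2 * (N * C + 1)) * enorm (g u' - g u))%:E)%E); last by near: u'.
rewrite leeD2l// lee_fin.
have := C11_expansion v Vu Vu'; rewrite ler_distl => /andP[+ _].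
have := C11_enorm Vu Vu'; have := norm_le_enorm (u' - u).
rewrite distrC ltr_pdivlMr// in ud.
set t := `|u' - u| in ud *; have t0 : 0 <= t by exact: normr_ge0.
set E := enorm (u' - u); set D := enorm _; set a := dotv _ _; set b := dotv _ _.
move=> tE DC ab.
have : N * (`|v| * (C * t ^+ 2)) <= e / 2 * t.
  have -> : N * (`|v| * (C * t ^+ 2)) = N * (`|v| * C) * t * t by ring.
  rewrite ler_wpM2r//; move: ud; set X := N * (`|v| * C) => ud; lra.
have : e / (2 * (N * C + 1)) * D <= e / 2 * t.
  rewrite invfM -!mulrA ler_wpM2l ?(ltW e0)// ler_wpM2l// mulrC.
  rewrite ler_pdivrMr//; last by rewrite ltr_wpDl// mulr_ge0.
  by rewrite (le_trans DC)// mulrC ler_wpM2l// lerDl.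
have : e * t <= e * E by rewrite ler_wpM2l// ltW.
by move: ab; lra.
Unshelve. all: by end_near. Qed.

(** On a closed ball mapped by g into the ball given for f, the sublevel sets of
h are the preimages under the continuous g of those of f. *)
Lemma locally_lsc_comp f h u : V u ->
  (forall u', V u' -> h u' = f (g u')) ->
  locally_lsc f (g u) -> locally_lsc h u.
Proof.
move=> Vu hE [fin [e e0 fcl]]; split; first by rewrite hE.
have [r /andP[r0 re] rV] := C11_ball Vu e0; exists r => // a ahr.
have /fcl clS : (a <= f (g u) + e%:E)%E.
  by rewrite (le_trans ahr)// hE// leeD2l// lee_fin.
move=> y yT.
have ry : enorm (y - u) <= r.
  by apply: (@closed_enorm_ball _ _ u r); apply: closure_subset yT => z [].
split=> //; have [Vy _] := rV _ ry; rewrite hE//.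
suff /clS[] :
  closure [set x | enorm (x - g u) <= e /\ (f x <= a)%E] (g y) by [].
move=> B /(C11_cvg Vy) gB; have [z [[rz ha] gBz]] := yT _ gB.
by have [Vz ez] := rV _ rz; exists (g z); split=> //; split=> //; rewrite -hE.
Qed.

End fixed_map.

(** The sequence x_n converging to g u is transported to G x_n, which converges
to u by continuity of the inverse; the pulled-back regular subgradients converge
because J is continuous. *)
Lemma limiting_subdiff_comp g J V G K W f h u v :
  C11_diffeo g J V G K W -> V u ->
  (forall u', V u' -> h u' = f (g u')) ->
  limiting_subdiff f (g u) v -> limiting_subdiff h u (v *m (J u)^T).
Proof.
move=> [[oV oW] gV GW [C gC] [D GD]] Vu hE [fin [xs [vs [xgu fxs rxs vsv]]]].
have [Wgu Ggu _] := gV _ Vu; split; first by rewrite hE.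
(* The inverse is only controlled on W: the first n0 terms are dropped. *)
have [n0 _ Wxs] : \forall n \near \oo, W (xs n).
  by apply: xgu; exact: open_nbhs_nbhs.
have Wx n : W (xs (n + n0)%N) by apply: Wxs; exact: leq_addl.
have xs0 : xs (n + n0)%N @[n --> \oo] --> g u by rewrite (cvg_shiftn n0 xs).
have us : G (xs (n + n0)%N) @[n --> \oo] --> u.
  rewrite -[X in _ --> X]Ggu; apply: (cvg_comp _ G xs0).
  exact: (C11_cvg oW GD).
exists (fun n => G (xs (n + n0)%N)),
  (fun n => vs (n + n0)%N *m (J (G (xs (n + n0)%N)))^T); split => //.
- rewrite hE//.
  have hf : (fun n => h (G (xs (n + n0)%N))) = (fun n => (f \o xs) (n + n0)%N).
    apply/funext => n /=; have [Vn gn] := GW _ (Wx n).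
    by rewrite hE// gn.
  have : f (xs (n + n0)%N) @[n --> \oo] --> f (g u).
    by rewrite (cvg_shiftn n0 (f \o xs)).
  by rewrite -hf.
- move=> n; have [Vn gn] := GW _ (Wx n).
  by apply: (regular_subdiff_comp oV gC Vn hE); rewrite gn.
- apply: cvg_mulmx; first by rewrite (cvg_shiftn n0 vs).
  apply: cvg_trmx; apply: (cvg_comp _ J us).
  exact: (C11_jacobian_cvg oV gC).
Qed.

(** A subgradient w of h at u1 is the pull-back of the subgradient
v = w *m (K (g u1))^T of f at g u1, which is close to vbar when w is close to
the pull-back of vbar and u1 is close to u. The prox-regularity inequality of f
at g u1 for v then gives that of h at u1 for w, with a larger constant. *)
Lemma prox_regular_comp g J V G K W f h u vbar :
  C11_diffeo g J V G K W -> V u ->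
  (forall u', V u' -> h u' = f (g u')) ->
  prox_regular f (g u) vbar -> prox_regular h u (vbar *m (J u)^T).
Proof.
move=> gG Vu hE [fin flsc fv [e [r [e0 r0 fprox]]]].
have [[oV oW] gV GW [C gC] [D GD]] := gG.
split; [by rewrite hE|exact: (locally_lsc_comp oV gC Vu hE)|
  exact: limiting_subdiff_comp gG Vu hE fv|].
have C0 := C11_ge0 gC Vu.
have [Wgu Ggu JKu] := gV _ Vu; have D0 := C11_ge0 GD Wgu.
set wbar := vbar *m _.
have vE : vbar = wbar *m (K (g u))^T.
  by rewrite -mulmxA -trmx_mul (mulmx1C JKu) trmx1 mulmx1.
have e20 : 0 < e / 2 by rewrite divr_gt0.
have [d /andP[d0 de] dV] := C11_ball oV gC Vu e20.
(* A Lipschitz constant: |v - vbar| <= L * max (|w - wbar|, |u1 - u|). *)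
pose L := N * (N * D + N * (`|wbar| * (D * C))).
have L0 : 0 <= L by rewrite mulr_ge0// addr_ge0// !mulr_ge0.
have L10 : 0 < L + 1 by rewrite ltr_wpDl.
(* The first summand accounts for the remainder of g paired with v, whose norm
   is at most |vbar| + e; the second for the quadratic term of f. *)
pose s := 2 * (N * ((`|vbar| + e) * C)) + r * (N * C) ^+ 2.
have s0 : 0 <= s.
  by rewrite addr_ge0// !mulr_ge0// ?exprn_ge0 ?mulr_ge0// addr_ge0// ltW.
exists (Num.min d (e / (L + 1))), s; split=> //.
  by rewrite lt_min d0 divr_gt0.
move=> u2 u1 w; rewrite !lt_min => /andP[u2d _] /andP[u1d u1e].
have [Vu2 gu2] := dV _ (ltW u2d); have [Vu1 gu1] := dV _ (ltW u1d).
rewrite !hE// => fe hw /andP[_ we].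
have [Wgu1 Ggu1 JK1] := gV _ Vu1.
pose v := w *m (K (g u1))^T.
have wE : w = v *m (J u1)^T.
  by rewrite -mulmxA -trmx_mul JK1 trmx1 mulmx1.
have fg1 : limiting_subdiff f (g u1) v.
  have fE x : W x -> f x = h (G x).
    by move=> Wx; have [VG gGx] := GW _ Wx; rewrite hE// gGx.
  by apply: (limiting_subdiff_comp (C11_diffeo_sym gG) Wgu1 fE); rewrite Ggu1.
have ve : enorm (v - vbar) < e.
  have -> : v - vbar = (w - wbar) *m (K (g u1))^T
      + wbar *m (K (g u1) - K (g u))^T.
    by rewrite vE /v linearB/= mulmxBl mulmxBr addrA subrK.
  rewrite (le_lt_trans (enorm_le_norm _))//.
  rewrite (@le_lt_trans _ _ (L * (e / (L + 1))))//; last first.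
    by rewrite mulrCA gtr_pMr// ltr_pdivrMr// mul1r ltrDl.
  rewrite /L -mulrA ler_wpM2l// (le_trans (ler_normD _ _))// [leRHS]mulrDl.
  have Ke := GD _ _ Wgu1 Wgu1; have KKe := GD _ _ Wgu Wgu1.
  rewrite lerD// (le_trans (norm_mulmx _ _))// norm_trmx -!mulrA ler_wpM2l//.
    rewrite mulrC ler_pM//; first by have [] := Ke.
    by rewrite (le_trans (norm_le_enorm _))// ltW.
  rewrite ler_wpM2l//; have [_ + _ _] := KKe; move=> /le_trans; apply.
  rewrite ler_wpM2l//; have [_ _ + _] := gC _ _ Vu Vu1.
  move=> /le_trans; apply; rewrite ler_wpM2l//.
  by rewrite (le_trans (norm_le_enorm _))// ltW.
have lt_e2 x : enorm x <= e / 2 -> enorm x < e.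
  by move=> /le_lt_trans; apply; rewrite ltr_pdivrMr// ltr_pMr// ltr1n.
have fin1 : f (g u1) \is a fin_num by case: fg1.
have fee : (f (g u1) - f (g u) < e%:E)%E.
  rewrite (lt_le_trans fe)// lee_fin ge_min; apply/orP; left.
  by rewrite (le_trans de)// ler_pdivrMr// ler_pMr// ler1n.
have := fprox (g u2) (g u1) v (lt_e2 _ gu2) (lt_e2 _ gu1) fee fg1 ve.
apply: le_trans; rewrite leeD2l// lee_fin.
have := C11_expansion gC v Vu1 Vu2; rewrite -wE ler_distl => /andP[+ _].
have := C11_enorm gC Vu1 Vu2; have := norm_le_enorm (u2 - u1).
set t := `|u2 - u1|; set E := enorm (u2 - u1); set F := enorm _.
set a := dotv _ _; set b := dotv _ _ => tE FC ab.
have t0 : 0 <= t by exact: normr_ge0.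
have F0 : 0 <= F by exact: enorm_ge0.
have tE2 : t ^+ 2 <= E ^+ 2 by rewrite ler_pXn2r ?nnegrE ?(le_trans t0 tE).
have F2 : F ^+ 2 <= (N * C) ^+ 2 * t ^+ 2.
  by rewrite -exprMn ler_pXn2r ?nnegrE// !mulr_ge0.
have vb : `|v| <= `|vbar| + e.
  rewrite -lerBlDl (le_trans (lerB_dist _ _))//.
  by rewrite (le_trans (norm_le_enorm _))// ltW.
have H1 : N * (`|v| * (C * t ^+ 2)) <= N * ((`|vbar| + e) * C) * t ^+ 2.
  by rewrite -!mulrA ler_wpM2l// ler_wpM2r// mulr_ge0// exprn_ge0.
have H2 : r / 2 * F ^+ 2 <= r / 2 * ((N * C) ^+ 2 * t ^+ 2).
  by rewrite ler_wpM2l// divr_ge0.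
have H3 : s / 2 * t ^+ 2 <= s / 2 * E ^+ 2 by rewrite ler_wpM2l// divr_ge0.
have H4 : s / 2 * t ^+ 2 = N * ((`|vbar| + e) * C) * t ^+ 2
    + r / 2 * ((N * C) ^+ 2 * t ^+ 2) by rewrite /s; field.
lra.
Qed.

End change_of_variables.

(** * Calculus on row vectors *)

Section calculus.
Variables (R : realType) (m : nat).
Implicit Types (x d u : 'rV[R]_m).
Local Notation N := (m.+1%:R : R).

Lemma is_derive_line (F : 'rV[R]_m -> R) x d (t l : R) :
  is_derive (x + t *: d) d F l -> is_derive t 1 (fun s : R => F (x + s *: d)) l.
Proof.
move=> [dF <-].
have E : (fun h : R => h^-1 *: (((fun s => F (x + s *: d)) \o shift t) (h *: 1)
      - F (x + t *: d))) =
    (fun h : R =>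
      h^-1 *: ((F \o shift (x + t *: d)) (h *: d) - F (x + t *: d))).
  apply/funext => h /=; congr (_ *: (F _ - _)).
  by rewrite [h *: 1]mulr1 scalerDl addrCA.
by split; rewrite /derivable /derive E.
Qed.

Lemma is_derive_dotv (G : 'rV[R]_m -> 'rV[R]_m) x d l w :
  is_derive x d G l -> is_derive x d (fun y => dotv (G y) w) (dotv l w).
Proof.
move=> [dG <-].
have E : (fun h : R => h^-1 *: (((fun y => dotv (G y) w) \o shift x) (h *: d)
      - dotv (G x) w)) =
    (fun h : R => dotv (h^-1 *: ((G \o shift x) (h *: d) - G x)) w).
  by apply/funext => h /=; rewrite dotvZl dotvBl.
have cv : h^-1 *: (((fun y => dotv (G y) w) \o shift x) (h *: d)
      - dotv (G x) w) @[h --> 0^'] --> dotv ('D_d G x) w.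
  by rewrite E; apply: cvg_dotv; [exact: dG|exact: cvg_cst].
by split; [apply/cvg_ex; exists (dotv ('D_d G x) w)|exact: cvg_lim].
Qed.

Lemma mean_value_unit (f df : R -> R) :
  (forall t : R, 0 <= t <= 1 -> is_derive t 1 f (df t)) ->
  exists2 t : R, 0 <= t <= 1 & f 1 - f 0 = df t.
Proof.
move=> fdf; have [] := @MVT_segment R f df 0 1 ler01.
- by move=> t; rewrite in_itv/= => /andP[t0 t1]; apply: fdf; rewrite !ltW.
- apply: derivable_within_continuous => t; rewrite in_itv/= => /fdf[+ _].
  exact.
- by move=> t; rewrite in_itv/= subr0 mulr1; exists t.
Qed.

(** A one-sided bound on the increments suffices, since the derivative is also
the limit from the right. This serves first-order optimality conditions and
consequences of convexity, where only small t > 0 are available. *)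
Lemma is_derive_ge (F : 'rV[R]_m -> R) x d (l k e : R) :
  is_derive x d F l -> 0 < e ->
  (forall t, 0 < t < e -> k * t <= F (x + t *: d) - F x) -> k <= l.
Proof.
move=> [dF <-] e0 kF; rewrite leNgt; apply/negP => lk.
have [r /= r0 rF] := cvgr_lt _ dF _ lk.
pose t := Num.min e r / 2.
have m0 : 0 < Num.min e r by rewrite lt_min e0.
have t0 : 0 < t by rewrite divr_gt0.
have : t < Num.min e r by rewrite ltr_pdivrMr// ltr_pMr// ltr1n.
rewrite lt_min => /andP[te tr].
have /= := rF t; rewrite /ball/= sub0r normrN gtr0_norm//.
move=> /(_ tr (lt0r_neq0 t0)).
rewrite /= -[_ *: _]/(_ * _) mulrC ltr_pdivrMr// ltNge.
by rewrite [t *: d + x]addrC kF// t0.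
Qed.

Lemma is_derive_le (F : 'rV[R]_m -> R) x d (l k e : R) :
  is_derive x d F l -> 0 < e ->
  (forall t, 0 < t < e -> F (x + t *: d) - F x <= k * t) -> l <= k.
Proof.
move=> dF e0 Fk; rewrite -lerN2.
apply: (@is_derive_ge (fun y => - F y) x d _ _ e (is_deriveN dF) e0) => t te.
by have := Fk t te; lra.
Qed.

Lemma is_derive_expansion (F : 'rV[R]_m -> R) x d (l C e : R) : 0 < e ->
  (forall t, `|t| < e -> `|F (x + t *: d) - F x - t * l| <= C * t ^+ 2) ->
  is_derive x d F l.
Proof.
move=> e0 FC.
have cv : h^-1 *: ((F \o shift x) (h *: d) - F x) @[h --> 0^'] --> l.
  apply/cvgrPdist_lt => k k0; have C0 : 0 < `|C| + 1 by rewrite ltr_wpDl.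
  exists (Num.min e (k / (`|C| + 1))) => /=.
    by rewrite lt_min e0 divr_gt0.
  move=> t; rewrite /ball/= sub0r normrN lt_min ltr_pdivlMr//.
  move=> /andP[te tk] tn0.
  have t0 : 0 < `|t| by rewrite normr_gt0.
  rewrite distrC -(ltr_pM2l t0) -normrM mulrBr.
  rewrite [in X in X - _]mulrA divff// mul1r.
  rewrite [t *: d + x]addrC; apply: le_lt_trans (FC _ te) _.
  rewrite -real_normK ?num_real// expr2 mulrCA ltr_pM2l// mulrC.
  apply: le_lt_trans tk; rewrite ler_wpM2l// (le_trans (ler_norm _))//.
  by rewrite lerDl.
by split; [apply/cvg_ex; exists l|exact: cvg_lim].
Qed.

Lemma differentiable_is_derive (G : 'rV[R]_m -> 'rV[R]_m) x d :
  differentiable G x -> is_derive x d G (d *m 'J G x).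
Proof.
by move=> dG; split; [exact: diff_derivable|exact: deriveEjacobian].
Qed.

Lemma grad_is_derive (phi : 'rV[R]_m -> \bar R) x d :
  differentiable (fine \o phi : 'rV[R]_m -> R) x ->
  is_derive x d (fine \o phi : 'rV[R]_m -> R) (dotv (grad phi x) d).
Proof.
move=> dphi; split; first exact: diff_derivable.
rewrite deriveE// [in LHS](row_sum_delta d) linear_sum; apply: eq_bigr => i _.
by rewrite linearZ/= mxE deriveE// mulrC.
Qed.

(** The quadratic remainder makes right multiplication by J u the
differential of g at u. *)
Lemma C11_jacobian g J V C u : open V -> V u -> @C11_map R m g J V C ->
  'J g u = J u.
Proof.
move=> oV Vu gC; have C0 := C11_ge0 gC Vu.
pose dg : {linear 'rV[R]_m -> 'rV[R]_m} := mulmxr (J u).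
have dgc : continuous dg.
  move=> v; exact: (@cvg_mulmx R _ (nbhs v) 1 m m id (cst (J u)) v (J u) _
    cvg_id (cvg_cst _)).
have E : g \o shift u = cst (g u) + dg +o_ (0 : 'rV[R]_m) id.
  apply/eqaddoP => e e0.
  have VN : \forall v \near (0 : 'rV[R]_m), V (v + u).
    have : (fun v => v + u) @ (0 : 'rV[R]_m) --> 0 + u.
      exact: (@cvgD _ _ _ (nbhs 0) _ id (cst u) _ _ cvg_id (cvg_cst _)).
    by rewrite add0r; apply; exact: open_nbhs_nbhs.
  have C1 : 0 < C + 1 by rewrite ltr_wpDl.
  have NN := @near_dist_lt R 'rV[R]_m 0 _ (divr_gt0 e0 C1).
  near=> v.
  have Vv : V (v + u) by near: v.
  have : `|0 - v| < e / (C + 1) by near: v.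
  rewrite sub0r normrN ltr_pdivlMr// => ve /=.
  have [_ _ _] := gC _ _ Vu Vv; rewrite addrK /dg /= /mulmxr.
  rewrite !fctE /= opprD addrA => /le_trans; apply.
  rewrite expr2 mulrA ler_wpM2r//; apply: le_trans (ltW ve).
  by rewrite mulrC ler_wpM2l// lerDl.
rewrite /jacobian (diff_unique dgc E); apply/row_matrixP => i.
by rewrite !rowE mul_rV_lin1.
Unshelve. all: by end_near. Qed.

(** The inverse of a map of this kind is again of this kind when the map is
expansive and its Jacobians have bounded inverses. The Lipschitz estimate for
the inverse matrices comes from A'^-1 - A^-1 = A'^-1 (A - A') A^-1, and the
Taylor estimate from multiplying that of the map by K x ^-1. *)
Lemma C11_inverse g (V : set 'rV[R]_m) G K (W : set 'rV[R]_m) (B D : R) :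
  (forall u, V u -> W (g u) /\ G (g u) = u) ->
  @C11_map R m G K W D ->
  (forall x x', W x -> W x' -> `|x' - x| <= B * `|G x' - G x|) ->
  (forall x, W x -> K x \in unitmx /\ `|invmx (K x)| <= B) ->
  exists C, C11_map g (fun u => invmx (K (g u))) V C.
Proof.
move=> gV GD GB KB.
exists (B + N * (N * (B * B * (D * B))) + N * ((D * B ^+ 2) * B)).
move=> u u' Vu Vu'.
have [Wx Gx] := gV _ Vu; have [Wx' Gx'] := gV _ Vu'.
set x := g u in Wx Gx *; set x' := g u' in Wx' Gx' *.
have [Ku JB] := KB _ Wx; have [Ku' JB'] := KB _ Wx'.
have B0 : 0 <= B by apply: le_trans JB.
have D0 := C11_ge0 GD Wx.
have xx' : `|x' - x| <= B * `|u' - u| by rewrite -Gx -Gx' GB.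
have [_ KD _ ED] := GD _ _ Wx Wx'.
set C1 := N * (N * (B * B * (D * B))); set C2 := N * _.
have C10 : 0 <= C1 by rewrite !mulr_ge0.
have C20 : 0 <= C2 by rewrite !mulr_ge0// exprn_ge0.
split.
- by rewrite (le_trans JB)// -addrA lerDl addr_ge0.
- have -> : invmx (K x') - invmx (K x) =
      invmx (K x') *m ((K x - K x') *m invmx (K x)).
    by rewrite mulmxBl mulmxBr mulmxV// mulmx1 mulKmx.
  apply: (@le_trans _ _ (C1 * `|u' - u|)); last first.
    by rewrite ler_wpM2r// addrAC lerDr addr_ge0.
  rewrite (le_trans (norm_mulmx _ _))// /C1 -mulrA ler_wpM2l//.
  apply: (@le_trans _ _ (B * (N * (D * (B * `|u' - u|) * B)))); last first.
    by rewrite le_eqVlt; apply/orP; left; apply/eqP; ring.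
  rewrite ler_pM// (le_trans (norm_mulmx _ _))// ler_wpM2l// ler_pM//.
  by rewrite distrC (le_trans KD)// ler_wpM2l.
- by rewrite (le_trans xx')// ler_wpM2r// -addrA lerDl addr_ge0.
- have -> : x' - x - (u' - u) *m invmx (K x) =
      - ((G x' - G x - (x' - x) *m K x) *m invmx (K x)).
    by rewrite [in RHS]mulmxBl mulmxK// opprB Gx Gx'.
  rewrite normrN; apply: (@le_trans _ _ (C2 * `|u' - u| ^+ 2)); last first.
    by rewrite ler_wpM2r ?exprn_ge0// lerDr addr_ge0.
  rewrite (le_trans (norm_mulmx _ _))// /C2 -mulrA ler_wpM2l//.
  apply: (@le_trans _ _ (D * (B * `|u' - u|) ^+ 2 * B)); last first.
    by rewrite le_eqVlt; apply/orP; left; apply/eqP; ring.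
  rewrite ler_pM// (le_trans ED)// ler_wpM2l// ler_pXn2r ?nnegrE//.
  by rewrite mulr_ge0.
Qed.

(** The quadratic form attains its minimum on the unit sphere, which is
compact; homogeneity extends the bound to all vectors. *)
Lemma posdef_lower_bound (A : 'M[R]_m) :
  (forall w : 'rV[R]_m, w != 0 -> 0 < dotv (w *m A) w) ->
  exists2 c : R, 0 < c & forall w : 'rV[R]_m, c * `|w| ^+ 2 <= dotv (w *m A) w.
Proof.
move=> A0; pose q w := dotv (w *m A) w; pose S := [set w : 'rV[R]_m | `|w| = 1].
have scale c : (forall w, S w -> c <= q w) -> forall w, c * `|w| ^+ 2 <= q w.
  move=> Sc w; have [->|w0] := eqVneq w 0.
    by rewrite normr0 expr0n/= mulr0 /q mul0mx dotvE mul0mx mxE.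
  have nw : 0 < `|w| by rewrite normr_gt0.
  have /Sc : S (`|w|^-1 *: w).
    by rewrite /S/= normrZ normfV normr_id mulVf// gt_eqF.
  rewrite /q -scalemxAl dotvZl dotvZr mulrA -expr2 exprVn mulrC.
  by rewrite ler_pdivlMr// exprn_gt0.
(* In dimension 0 the sphere is empty and any constant works. *)
have [S0|/set0P/negP/negPn/eqP S0] := pselect (S !=set0); last first.
  by exists 1 => //; apply: scale => w; rewrite S0.
have cS : compact S.
  apply: bounded_closed_compact.
    by exists 1; split => // r r1 w /= ->; exact: ltW.
  apply: (continuous_closedP _).1 (@norm_continuous _ _) [set 1] _.
  exact: closed_eq.
have cq : {within S, continuous q}.
  apply: continuous_subspaceT => w.
  apply: (@cvg_dotv R m _ (nbhs w) (fun w => w *m A) id) cvg_id.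
  exact: (@cvg_mulmx R _ (nbhs w) 1 m m id (cst A) w A _ cvg_id (cvg_cst _)).
have [w0 Sw0 min_w0] := EVT_min_rV S0 cS cq.
exists (q w0).
  apply: A0; apply/negP => /eqP w00; move: Sw0; rewrite w00 inE /S/= normr0.
  by move=> /esym/eqP; rewrite oner_eq0.
by apply: scale => w Sw; apply: min_w0; rewrite inE.
Qed.

(** Coercivity and the Cauchy-Schwarz type bound on <w *m A, w> give
c |w| <= N |w *m A|, hence injectivity of A and a bound on its inverse. *)
Lemma coercive_unitmx (A : 'M[R]_m) (c : R) : 0 < c ->
  (forall w : 'rV[R]_m, c * `|w| ^+ 2 <= dotv (w *m A) w) ->
  A \in unitmx /\ `|invmx A| <= N / c.
Proof.
move=> c0 Ac.
have bnd (w : 'rV[R]_m) : `|w| <= N / c * `|w *m A|.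
  have [->|w0] := eqVneq w 0; first by rewrite normr0 mulr_ge0// divr_ge0// ltW.
  rewrite -mulrA mulrCA ler_pdivlMl// -(ler_pM2r (_ : 0 < `|w|)) ?normr_gt0//.
  rewrite -mulrA -expr2 -mulrA (le_trans (Ac w))//.
  by rewrite (le_trans (ler_norm _))// norm_dotv.
have Au : A \in unitmx.
  rewrite -row_free_unit; apply: inj_row_free => v vA.
  by apply/eqP; rewrite -normr_le0 (le_trans (bnd v))// vA normr0 mulr0.
split=> //; apply: mx_norm_le => [|i j]; first by rewrite divr_ge0// ltW.
have -> : invmx A i j = row i (invmx A) 0 j by rewrite mxE.
rewrite (le_trans (le_mx_norm _ _ _))// rowE (le_trans (bnd _))// mulmxKV//.
rewrite ler_piMr// ?divr_ge0 ?(ltW c0)//; apply: mx_norm_le => // k l.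
by rewrite mxE; case: (_ && _); rewrite ?normr1 ?normr0.
Qed.

(** Positive definiteness at one point gives a coercivity constant there; by
Lipschitz continuity, half of it remains valid on a small ball. *)
Lemma lipschitz_coercive_near (K : 'rV[R]_m -> 'M[R]_m) (A : set 'rV[R]_m) x0 :
  nbhs x0 A -> [lipschitz K y | y in A] ->
  (forall w : 'rV[R]_m, w != 0 -> 0 < dotv (w *m K x0) w) ->
  exists r c L : R, [/\ 0 < r, 0 < c,
    forall x, `|x0 - x| < r -> [/\ A x, `|K x| <= L &
      forall w : 'rV[R]_m, c * `|w| ^+ 2 <= dotv (w *m K x) w]
  & forall x x', `|x0 - x| < r -> `|x0 - x'| < r ->
      `|K x' - K x| <= L * `|x' - x| ].
Proof.
move=> x0A lipK posK; have [c0 c00 Kc0] := posdef_lower_bound posK.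
have [M [M0 KM]] :=
  filter_ex (filterI (nbhs_pinfty_gt (num_real (0 : R))) lipK).
have {}KM x x' : A x -> A x' -> `|K x' - K x| <= M * `|x' - x|.
  by move=> Ax Ax'; exact: (KM (x', x) (conj Ax' Ax)).
have [s s0 sA] := near_ex_dist x0A.
have Ax0 : A x0 by apply: sA; rewrite subrr normr0.
have c20 : 0 < c0 / 2 by rewrite divr_gt0.
have NM : 0 < N * (N * M) by rewrite !mulr_gt0.
pose r := Num.min s (c0 / 2 / (N * (N * M))).
have r0 : 0 < r by rewrite lt_min s0 divr_gt0.
have rs x : `|x0 - x| < r -> A x.
  by move=> xr; apply: sA; rewrite (lt_le_trans xr)// ge_min lexx.
have rc x : `|x0 - x| < r -> N * (N * M) * `|x0 - x| <= c0 / 2.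
  by rewrite lt_min => /andP[_ /ltW]; rewrite ler_pdivlMr// mulrC.
exists r, (c0 / 2), (M + (`|K x0| + M * r)); split => // [x xr|x x' xr xr'].
  have Kx : `|K x0 - K x| <= M * `|x0 - x| by apply: KM => //; exact: rs.
  split; first exact: rs.
    rewrite ler_wpDl ?(ltW M0)// -lerBlDl (le_trans (lerB_dist _ _))// distrC.
    by rewrite (le_trans Kx)// ler_wpM2l ?ltW.
  move=> w; have : dotv (w *m (K x0 - K x)) w <= c0 / 2 * `|w| ^+ 2.
    rewrite (le_trans (ler_norm _))// (le_trans (norm_dotv _ _))//.
    apply: (@le_trans _ _ (N * (N * M) * `|x0 - x| * `|w| ^+ 2)); last first.
      by rewrite ler_wpM2r ?exprn_ge0// rc.
    rewrite expr2 mulrA -!mulrA ler_wpM2l// !mulrA ler_wpM2r//.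
    rewrite (le_trans (norm_mulmx _ _))// -!mulrA ler_wpM2l//.
    by rewrite mulrC mulrA ler_wpM2r.
  rewrite mulmxBr dotvBl; have := Kc0 w.
  by set a := dotv _ _; set b := dotv _ _; set t := _ ^+ 2; lra.
have := KM _ _ (rs _ xr) (rs _ xr') => /le_trans; apply.
by rewrite ler_wpM2r// lerDl addr_ge0// mulr_ge0// ltW.
Qed.

Lemma mulmx_coord_sub (g d : 'rV[R]_m) (A B : 'M[R]_m) i :
  g 0 i = (d *m B) 0 i -> (g - d *m A) 0 i = (d *m (B - A)) 0 i.
Proof.
by move=> gi; rewrite mulmxBr mxE [in RHS]mxE gi; congr (_ + _); rewrite !mxE.
Qed.

Lemma dist_segment (x0 x y : 'rV[R]_m) (r t : R) :
  `|x0 - x| < r -> `|x0 - y| < r ->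
  0 <= t <= 1 -> `|x0 - (x + t *: (y - x))| < r.
Proof.
move=> xr yr /andP[t0 t1].
have -> : x0 - (x + t *: (y - x)) = (1 - t) *: (x0 - x) + t *: (x0 - y).
  by apply/rowP => i; rewrite !mxE; ring.
rewrite (le_lt_trans (ler_normD _ _))// !normrZ (ger0_norm t0).
rewrite ger0_norm ?subr_ge0//.
have [->|tn0] := eqVneq t 0; first by rewrite subr0 mul1r mul0r addr0.
have tp : 0 < t by rewrite lt_neqAle eq_sym tn0.
apply: (@lt_le_trans _ _ ((1 - t) * r + t * r)); last first.
  by rewrite -mulrDl subrK mul1r.
by rewrite ler_ltD ?ltr_pM2l// ler_wpM2l ?subr_ge0// ltW.
Qed.

End calculus.

(** * Gradient of a smooth convex function and of its conjugate *)

Section smooth_convex.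
Variables (R : realType) (m : nat) (phi : 'rV[R]_m -> \bar R).
Implicit Types (x y u v w a b : 'rV[R]_m).
Local Notation N := (m.+1%:R : R).
Local Notation U := ((dom phi)°).
Local Notation F := (fine \o phi : 'rV[R]_m -> R).
Local Notation G := (grad phi).
Local Notation H := (hess phi).
Hypotheses (phi_proper : Defs.proper phi) (phi_convex : econvex phi).
Hypothesis phiC2 : C2_on phi U.

Let dF x d : U x -> is_derive x d F (dotv (G x) d).
Proof. by move=> /phiC2[dphi _ _]; exact: grad_is_derive. Qed.

Let dG x d w : U x -> is_derive x d (fun y => dotv (G y) w) (dotv (d *m H x) w).
Proof.
move=> /phiC2[_ dg _]; apply: is_derive_dotv.
exact: differentiable_is_derive.
Qed.

Lemma grad_mean_value x y w :
  (forall t : R, 0 <= t <= 1 -> U (x + t *: (y - x))) ->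
  exists2 t : R, 0 <= t <= 1 &
    dotv (G y - G x) w = dotv ((y - x) *m H (x + t *: (y - x))) w.
Proof.
move=> Uxy; have [t t01] := mean_value_unit (fun t t01 =>
  is_derive_line (dG (y - x) w (Uxy t t01))).
by rewrite scale1r scale0r addr0 [x + (y - x)]addrC subrK -dotvBl; exists t.
Qed.

(** Two applications of the mean value theorem, first along a to the increment
of phi in the direction b, then along b to the gradient. *)
Lemma second_difference x a b :
  (forall s t : R, 0 <= s <= 1 -> 0 <= t <= 1 -> U (x + s *: b + t *: a)) ->
  exists s t : R, [/\ 0 <= s <= 1, 0 <= t <= 1 &
    F (x + b + a) - F (x + b) - F (x + a) + F x =
      dotv (b *m H (x + s *: b + t *: a)) a].
Proof.
move=> Uab; pose p : 'rV[R]_m -> R := F.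
rewrite -[F]/p.
have i0 : 0 <= (0 : R) <= 1 by rewrite lexx ler01.
have i1 : 0 <= (1 : R) <= 1 by rewrite lexx ler01.
have Ub t : 0 <= t <= 1 -> U (x + b + t *: a).
  by move=> /(Uab 1 t i1); rewrite scale1r.
have U0 t : 0 <= t <= 1 -> U (x + t *: a).
  by move=> /(Uab 0 t i0); rewrite scale0r addr0.
have [t t01] := mean_value_unit (fun t t01 =>
  is_deriveB (is_derive_line (dF a (Ub t t01)))
             (is_derive_line (dF a (U0 t t01)))).
rewrite !fctE !scale1r !scale0r !addr0 => Et.
have Us s : 0 <= s <= 1 -> U (x + t *: a + s *: b).
  by move=> s01; rewrite addrAC; exact: Uab.
have [s s01] := mean_value_unit (fun s s01 =>
  is_derive_line (dG b a (Us s s01))).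
rewrite scale1r scale0r addr0 => Es.
have Eab : p (x + b + a) - p (x + a) - (p (x + b) - p x) =
    dotv (b *m H (x + s *: b + t *: a)) a.
  rewrite (_ : x + s *: b + t *: a = x + t *: a + s *: b); last exact: addrAC.
  rewrite -Es.
  rewrite (_ : x + t *: a + b = x + b + t *: a); last exact: addrAC.
  exact: Et.
exists s, t; split=> [||]; [exact: s01|exact: t01|].
by rewrite -Eab; ring.
Qed.

(** The second difference of phi is symmetric in the two increments, so the two
ways of writing it as a value of the Hessian form at a nearby point agree. The
points converge to x with the increments, and the Hessian is continuous. *)
Lemma hess_sym x : U x -> (H x)^T = H x.
Proof.
move=> Ux; apply/eqP; rewrite eq_sym; apply/eqP.
suff sym a b : dotv (b *m H x) a = dotv (a *m H x) b.
  apply/row_matrixP => i; rewrite !rowE; apply: dotv_inj => w.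
  by rewrite sym dotv_mulmx dotvC.
have [_ _ cH] := phiC2 Ux.
have cts v w : (fun y => dotv (v *m H y) w) @ x --> dotv (v *m H x) w.
  apply: (@cvg_dotv R m _ (nbhs x) (fun y => v *m H y) (cst w)) (cvg_cst _).
  exact: (@cvg_mulmx R _ (nbhs x) 1 m m (cst v) H v (H x) _ (cvg_cst _) cH).
apply/eqP; rewrite -subr_eq0 -normr_le0 leNgt; apply/negP => D0.
set D := `|_| in D0; have D20 : 0 < D / 2 by rewrite divr_gt0.
have /cvgrPdist_lt/(_ _ D20) Ca := cts b a.
have /cvgrPdist_lt/(_ _ D20) Cb := cts a b.
have NU : \forall y \near x, U y.
  by apply: open_nbhs_nbhs; split=> //; exact: open_interior.
have [r r0 rP] := near_ex_dist (filterI (filterI Ca Cb) NU).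
(* With the scale h, the parallelogram spanned by h *: a and h *: b at x stays
   in the ball of radius r. *)
have S0 : 0 < `|a| + `|b| + 1 by rewrite ltr_wpDl// addr_ge0.
have [h h0 hr] : exists2 h, 0 < h & h * (`|a| + `|b| + 1) = r.
  by exists (r / (`|a| + `|b| + 1)); rewrite ?divr_gt0// divfK ?gt_eqF.
have inr p q s t : `|p| + `|q| <= `|a| + `|b| -> 0 <= s <= 1 -> 0 <= t <= 1 ->
    `|x - (x + s *: (h *: p) + t *: (h *: q))| < r.
  move=> pq /andP[s0 s1] /andP[t0 t1].
  rewrite -addrA opprD addrA subrr sub0r normrN.
  rewrite (le_lt_trans (ler_normD _ _))// !normrZ.
  rewrite (ger0_norm s0) (ger0_norm t0) (gtr0_norm h0).
  apply: (@le_lt_trans _ _ (h * (`|p| + `|q|))).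
    by rewrite mulrDr lerD// ler_piMl// mulr_ge0// ltW.
  apply: (@le_lt_trans _ _ (h * (`|a| + `|b|))).
    by rewrite ler_wpM2l// ltW.
  by rewrite -hr ltr_pM2l// ltrDl.
have ab := lexx (`|a| + `|b|).
have ba : `|b| + `|a| <= `|a| + `|b| by rewrite addrC.
have [s1 [t1 [s101 t101 E1]]] := @second_difference x (h *: a) (h *: b)
  (fun s t s01 t01 => (rP _ (inr b a s t ba s01 t01)).2).
have [s2 [t2 [s201 t201 E2]]] := @second_difference x (h *: b) (h *: a)
  (fun s t s01 t01 => (rP _ (inr a b s t ab s01 t01)).2).
have [[d1 _] _] := rP _ (inr b a s1 t1 ba s101 t101).
have [[_ d2] _] := rP _ (inr a b s2 t2 ab s201 t201).
have quad p q (A : 'M[R]_m) :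
    dotv (h *: p *m A) (h *: q) = h * (h * dotv (p *m A) q).
  by rewrite -scalemxAl dotvZl dotvZr.
rewrite quad in E1; rewrite quad in E2.
have E12 : F (x + h *: b + h *: a) - F (x + h *: b) - F (x + h *: a) + F x =
    F (x + h *: a + h *: b) - F (x + h *: a) - F (x + h *: b) + F x.
  rewrite (_ : x + h *: a + h *: b = x + h *: b + h *: a); last exact: addrAC.
  by congr (_ + _); exact: addrAC.
have /(mulfI (lt0r_neq0 h0))/(mulfI (lt0r_neq0 h0)) e12 :=
  etrans (esym E1) (etrans E12 E2).
by have := dist_lt_half d1 d2 e12; rewrite -/D ltxx.
Qed.

Lemma fin_num_interior_dom x : U x -> phi x \is a fin_num.
Proof.
move=> /interior_subset phix; rewrite fin_numE phi_proper.2/=.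
by move: phix; rewrite /dom/= lt_neqAle => /andP[].
Qed.

(** By convexity the slopes of phi from x towards y are at most
phi y - phi x; let the step tend to 0. *)
Lemma gradient_inequality x y : U x ->
  ((F x + dotv (G x) (y - x))%:E <= phi y)%E.
Proof.
move=> Ux; have fx := fin_num_interior_dom Ux.
have [_ /(_ y)] := phi_proper; case py : (phi y) => [q| |] // _; last first.
  exact: leey.
rewrite lee_fin -lerBrDl.
apply: (is_derive_le (dF (y - x) Ux) ltr01) => t /andP[t0 t1].
have := @phi_convex y x t; rewrite t0 t1 => /(_ isT).
have -> : t *: y + (1 - t) *: x = x + t *: (y - x).
  by rewrite scalerBr scalerBl scale1r addrC addrA addrAC.
rewrite py -[phi x]fineK// -!EFinM -EFinD.
have [_ /(_ (x + t *: (y - x)))] := phi_proper; rewrite /=.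
case: (phi _) => [p| |] // _; rewrite lee_fin/= => pq.
by move: pq; set r := fine _ => pq; lra.
Qed.

Lemma conjugate_ge v x : U x ->
  ((dotv v x - F x)%:E <= conjugate phi v)%E.
Proof.
move=> Ux; apply: ereal_sup_ubound; exists x => //.
by rewrite -[phi x]fineK// fin_num_interior_dom.
Qed.

(** Equality case of the Fenchel-Young inequality: by the gradient inequality
the supremum defining the conjugate at G x is attained at x. *)
Lemma conjugate_grad x : U x ->
  conjugate phi (G x) = (dotv (G x) x - F x)%:E.
Proof.
move=> Ux; apply/eqP; rewrite eq_le conjugate_ge// andbT.
apply: ge_ereal_sup => _ [y _ <-].
have := gradient_inequality y Ux; have [_ /(_ y)] := phi_proper.
case: (phi y) => [q| |] // _; rewrite ?leNye// !lee_fin dotvBr.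
set p := F x; lra.
Qed.

Section around_a_point.
Variables (x0 : 'rV[R]_m) (r c L : R).
Local Notation B := [set x | `|x0 - x| < r].
Hypotheses (r0 : 0 < r) (c0 : 0 < c).
Hypothesis BU : forall x, B x -> U x.
Hypothesis H_bounded : forall x, B x -> `|H x| <= L.
Hypothesis H_lipschitz : forall x x', B x -> B x' ->
  `|H x' - H x| <= L * `|x' - x|.
Hypothesis H_coercive : forall x w, B x ->
  c * `|w| ^+ 2 <= dotv (w *m H x) w.

Let Bx0 : B x0. Proof. by rewrite /= subrr normr0. Qed.

Let grad_mean_value_ball x x' w : B x -> B x' ->
  exists2 y, B y /\ `|y - x| <= `|x' - x| &
  dotv (G x' - G x) w = dotv ((x' - x) *m H y) w.
Proof.
move=> Bx Bx'.
have Ux t : 0 <= t <= 1 -> U (x + t *: (x' - x)).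
  by move=> t01; apply: BU; exact: dist_segment.
have [t t01 E] := grad_mean_value w Ux.
exists (x + t *: (x' - x)); last exact: E.
split; first exact: dist_segment.
move: t01 => /andP[t0 t1].
by rewrite addrC addKr normrZ ger0_norm// ler_piMl.
Qed.

Lemma grad_C11 : C11_map G H B (N * L).
Proof.
move=> x x' Bx Bx'; have L0 : 0 <= L by apply: le_trans (H_bounded Bx).
have LN : L <= N * L by rewrite ler_peMl// ler1n.
have coord i : exists2 y, B y /\ `|y - x| <= `|x' - x| &
    (G x' - G x) 0 i = ((x' - x) *m H y) 0 i.
  have [y By E] := grad_mean_value_ball (delta_mx 0 i) Bx Bx'.
  by exists y => //; move: E; rewrite !dotv_delta.
split.
- exact: le_trans (H_bounded Bx) LN.
- by apply: le_trans (H_lipschitz Bx Bx') _; rewrite ler_wpM2r.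
- apply: mx_norm_le => [|k i]; first by rewrite !mulr_ge0.
  rewrite (ord1 k); have [y [By _] ->] := coord i.
  apply: le_trans (le_mx_norm _ _ _) _; apply: le_trans (norm_mulmx _ _) _.
  by rewrite -mulrA ler_wpM2l// mulrC ler_wpM2r// H_bounded.
- apply: mx_norm_le => [|k i]; first by rewrite !mulr_ge0// exprn_ge0.
  rewrite (ord1 k); have [y [By yx] E] := coord i.
  rewrite (mulmx_coord_sub _ E).
  apply: le_trans (le_mx_norm _ _ _) _; apply: le_trans (norm_mulmx _ _) _.
  rewrite -mulrA ler_wpM2l// expr2 mulrCA ler_wpM2l//.
  by apply: le_trans (H_lipschitz Bx By) _; rewrite ler_wpM2l.
Qed.

(** Along a segment the increment of G is the Hessian at an intermediate point
applied to the step, so coercivity of the Hessian passes to G. *)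
Lemma grad_strongly_monotone x x' : B x -> B x' ->
  c * `|x' - x| ^+ 2 <= dotv (G x' - G x) (x' - x).
Proof.
move=> Bx Bx'; have [y [By _] ->] := grad_mean_value_ball (x' - x) Bx Bx'.
exact: H_coercive.
Qed.

Lemma grad_expansive x x' : B x -> B x' -> `|x' - x| <= N / c * `|G x' - G x|.
Proof.
move=> Bx Bx'; have := grad_strongly_monotone Bx Bx'.
have := le_trans (ler_norm _) (norm_dotv (G x' - G x) (x' - x)).
move=> /[swap] /le_trans /[apply].
set d := `|x' - x|; set e := `|G x' - G x|; rewrite mulrA.
have : 0 <= d by exact: normr_ge0.
rewrite le_eqVlt => /predU1P[<- _|d0].
  by apply: mulr_ge0; [apply: divr_ge0 => //; exact: ltW|exact: normr_ge0].
by rewrite expr2 mulrA ler_pM2r// -mulrA mulrCA ler_pdivlMl.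
Qed.

(** The solution of G x = u is the minimiser of phi - <., u> over the closed
ball of radius r / 2. Optimality in the direction of x0 and strong monotonicity
bound its distance to x0 by N |u - G x0| / c, which puts it in the interior of
that ball; there optimality holds in every direction. *)
Lemma grad_onto u : N * `|u - G x0| < c * (r / 2) -> exists2 x, B x & G x = u.
Proof.
move=> ur; pose d := r / 2; pose S := [set y | `|x0 - y| <= d].
have d0 : 0 < d by rewrite divr_gt0.
have SB x : S x -> B x.
  by move=> /le_lt_trans; apply; rewrite ltr_pdivrMr// ltr_pMr// ltr1n.
pose q y := F y - dotv y u.
have dq x e : B x -> is_derive x e q (dotv (G x - u) e).
  move=> Bx; rewrite dotvBl [dotv u e]dotvC.
  exact: is_deriveB (dF e (BU Bx)) (is_derive_dotv u (is_derive_id x e)).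
have S0 : S !=set0 by exists x0; rewrite /S/= subrr normr0 ltW.
have cS : compact S.
  apply: bounded_closed_compact; last exact: closed_closed_ball_.
  exists (`|x0| + d); split; first by rewrite num_real.
  move=> M ltM y /= yS; apply: ltW; apply: le_lt_trans ltM.
  by rewrite -lerBlDl (le_trans _ yS)// distrC lerB_dist.
have cq : {within S, continuous q}.
  apply: continuous_in_subspaceT => y; rewrite inE => /SB/BU Uy.
  have [dFy _ _] := phiC2 Uy.
  apply: (@cvgB _ _ _ (nbhs y) _ F (fun z => dotv z u)).
    exact: (differentiable_continuous dFy).
  exact: (@cvg_dotv R m _ (nbhs y) id (cst u) y u _ cvg_id (cvg_cst _)).
have [x Sx min_x] := EVT_min_rV S0 cS cq.
rewrite inE in Sx; have Bx := SB _ Sx.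
(* First-order optimality in the feasible directions. *)
have foc e k : 0 < k -> (forall t, 0 < t < k -> S (x + t *: e)) ->
    0 <= dotv (G x - u) e.
  move=> k0 Sk; apply: (is_derive_ge (dq x e Bx) k0) => t /Sk St.
  by rewrite mul0r subr_ge0; apply: min_x; rewrite inE.
have xd : `|x0 - x| < d.
  have : 0 <= dotv (G x - u) (x0 - x).
    apply: (foc _ 1) => // t /andP[t0 t1]; rewrite /S/=.
    have -> : x0 - (x + t *: (x0 - x)) = (1 - t) *: (x0 - x).
      by apply/rowP => i; rewrite !mxE; ring.
    rewrite normrZ gtr0_norm ?subr_gt0// (le_trans _ Sx)// ler_piMl//.
    by rewrite gerBl ltW.
  have := grad_strongly_monotone Bx0 Bx.
  have := le_trans (ler_norm _) (norm_dotv (u - G x0) (x - x0)).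
  have -> : dotv (G x - G x0) (x - x0) =
      dotv (u - G x0) (x - x0) - dotv (G x - u) (x0 - x).
    rewrite (_ : x0 - x = -1 *: (x - x0)); last by rewrite scaleN1r opprB.
    by rewrite dotvZr !dotvBl; ring.
  set a := dotv _ _; set b := dotv _ _; set t := `|x - x0|.
  rewrite [`|x0 - x|]distrC -/t => ab tb b0; rewrite ltNge; apply/negP => dt.
  have t0 : 0 < t by exact: lt_le_trans dt.
  have : c * t ^+ 2 <= N * `|u - G x0| * t by move: ab; rewrite mulrA; lra.
  rewrite expr2 mulrA ler_pM2r// => /le_lt_trans/(_ ur).
  by rewrite ltr_pM2l// ltNge dt.
exists x => //; apply/eqP.
rewrite -subr_eq0 -normr_eq0 -sqrf_eq0 eq_le sqr_ge0 andbT.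
have ge0 e : 0 <= dotv (G x - u) e.
  have e0 : 0 < `|e| + 1 by rewrite ltr_wpDl.
  apply: (foc _ ((d - `|x0 - x|) / (`|e| + 1))).
    by rewrite divr_gt0// subr_gt0.
  move=> t /andP[t0]; rewrite ltr_pdivlMr// => te; rewrite /S/=.
  rewrite opprD addrA (le_trans (ler_normB _ _))// normrZ gtr0_norm//.
  rewrite -lerBrDl (le_trans _ (ltW te))//.
  by apply: ler_wpM2l; [exact: ltW|rewrite lerDl].
rewrite (le_trans (norm_sqr_le_dotv _))//.
by have := ge0 (-1 *: (G x - u)); rewrite dotvZr mulN1r oppr_ge0.
Qed.

Let eta := c * (r / 2) / N.
Local Notation V := [set u | `|G x0 - u| < eta].

Let eta0 : 0 < eta. Proof. by rewrite !mulr_gt0// invr_gt0. Qed.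

Let VG u : V u -> exists2 x, B x & G x = u.
Proof.
move=> Vu; apply: grad_onto; rewrite distrC mulrC -ltr_pdivlMr//.
Qed.

(** Let y be the solution of G y = G x + t *: e. Testing the supremum defining
the conjugate at each of the two points with the maximiser at the other one
squeezes the increment of the conjugate between t <e, x> and t <e, y>, and
|y - x| is at most a multiple of |t|. *)
Lemma conjugate_is_derive x e : B x -> V (G x) ->
  is_derive (G x) e (fine \o conjugate phi : 'rV[R]_m -> R) (dotv x e).
Proof.
move=> Bx VGx; have e0 : 0 < `|e| + 1 by rewrite ltr_wpDl.
have eps0 : 0 < (eta - `|G x0 - G x|) / (`|e| + 1).
  by rewrite divr_gt0// subr_gt0.
apply: (@is_derive_expansion _ _ _ _ _ _ (N * `|e| * (N / c) * `|e|) _ eps0).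
move=> t; rewrite ltr_pdivlMr// => te.
have /VG[y By Gy] : V (G x + t *: e).
  rewrite /= opprD addrA (le_lt_trans (ler_normB _ _))// normrZ.
  rewrite -ltrBrDl (le_lt_trans _ te)// ler_wpM2l// lerDl//.
have yx : `|y - x| <= N / c * (`|t| * `|e|).
  rewrite (le_trans (grad_expansive Bx By))// Gy ler_wpM2l//.
    by rewrite divr_ge0// ltW.
  by rewrite addrC addKr normrZ.
have := conjugate_ge (G x) (BU By); have := conjugate_ge (G y) (BU Bx).
rewrite /= -Gy (conjugate_grad (BU Bx)) (conjugate_grad (BU By)) !lee_fin/=.
rewrite Gy !dotvDl !dotvZl [dotv x e]dotvC => h1 h2.
have bnd : `|t * dotv e (y - x)| <= N * `|e| * (N / c) * `|e| * t ^+ 2.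
  rewrite normrM -[t ^+ 2]real_normK ?num_real//.
  apply: (@le_trans _ _ (`|t| * (N * (`|e| * (N / c * (`|t| * `|e|)))))).
    rewrite ler_wpM2l// (le_trans (norm_dotv _ _))// ler_wpM2l// ler_wpM2l//.
  by rewrite le_eqVlt; apply/orP; left; apply/eqP; ring.
apply: le_trans bnd; rewrite dotvBr.
move: h1 h2; set Fx := fine _; set Fy := fine _.
set gx := dotv (G x) x; set gy := dotv (G x) y.
set ex := dotv e x; set ey := dotv e y => h1 h2.
rewrite ger0_norm; first by rewrite (le_trans _ (ler_norm _))//; lra.
by lra.
Qed.

Lemma grad_conjugate x : B x -> V (G x) -> grad (conjugate phi) (G x) = x.
Proof.
move=> Bx VGx; apply/rowP => i; rewrite mxE -[RHS]dotv_delta.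
by apply: derive_val; exact: conjugate_is_derive.
Qed.

Lemma interior_dom_conjugate u : V u -> (dom (conjugate phi))° u.
Proof.
have oV : open V.
  by have := ball_open (G x0) eta; rewrite -ball_normE.
move=> Vu; have : nbhs u V by exact: open_nbhs_nbhs.
apply: filterS => v /VG[x Bx <-].
by rewrite /dom/= (conjugate_grad (BU Bx)) ltey.
Qed.

Lemma grad_diffeo : exists V W,
  [/\ V (G x0), V `<=` (dom (conjugate phi))°,
      C11_diffeo (grad (conjugate phi))
        (fun u => invmx (H (grad (conjugate phi) u))) V G H W &
      (grad (conjugate phi)) (G x0) = x0].
Proof.
pose g := grad (conjugate phi).
have oV : open V.
  by have := ball_open (G x0) eta; rewrite -ball_normE.
have oB : open B.
  by have := ball_open x0 r; rewrite -ball_normE.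
have gV u : V u -> B (g u) /\ G (g u) = u.
  by move=> Vu; have [x Bx Gx] := VG Vu; rewrite -Gx /g grad_conjugate ?Gx.
have VG0 : V (G x0) by rewrite /= subrr normr0.
have Hunit x : B x -> H x \in unitmx /\ `|invmx (H x)| <= N / c.
  by move=> Bx; apply: coercive_unitmx c0 _ => w; exact: H_coercive.
(* V lies in the image of B, but G may map points of B outside V. *)
exists V, [set x | B x /\ V (G x)]; split => //.
- by move=> u; exact: interior_dom_conjugate.
- split.
  + split=> //; rewrite openE => x [Bx VGx].
    apply: filterI; first exact: open_nbhs_nbhs.
    by apply: (C11_cvg oB grad_C11 Bx); exact: open_nbhs_nbhs.
  + move=> u Vu; have [Bgu Ggu] := gV _ Vu; split=> //; first by rewrite /= Ggu.
    by rewrite mulVmx//; have [] := Hunit _ Bgu.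
  + by move=> x [Bx VGx]; split=> //; exact: grad_conjugate.
  + exact: (C11_inverse gV grad_C11 grad_expansive Hunit).
  + by exists (N * L) => x x' [Bx _] [Bx' _]; exact: grad_C11.
- exact: grad_conjugate.
Qed.

End around_a_point.

End smooth_convex.

(** * Prox-regularity of the composition with the conjugate gradient *)

Theorem corollary3p31 (R : realType) (m : nat)
    (phi f : 'rV[R]_m -> \bar R) (xbar : 'rV[R]_m) :
  Gamma0 phi -> Legendre phi -> very_strictly_convex phi ->
  (dom phi)° xbar -> hess_locally_lipschitz_at phi xbar ->
  f xbar \is a fin_num ->
  forall vbar : 'rV[R]_m,
    prox_regular f xbar vbar <->
    prox_regular (comp_grad_conjugate f phi) (grad phi xbar)
      (vbar *m hess (conjugate phi) (grad phi xbar)).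
Proof.
move=> [phi_proper _ phi_convex] _ [_ phiC2 H_posdef] Ux [A xA lipA] _ vbar.
have xU : nbhs xbar (dom phi)°.
  by apply: open_nbhs_nbhs; split=> //; exact: open_interior.
have lipAU : [lipschitz hess phi y | y in A `&` (dom phi)°].
  by apply: sub_lipschitz lipA => P AP [x y] [[Ax _] [Ay _]]; exact: AP.
have [r [c [L [r0 c0 bounds lipH]]]] :=
  lipschitz_coercive_near (filterI xA xU) lipAU (fun w => H_posdef xbar w Ux).
have [V [W [Vu VU gG gx]]] := @grad_diffeo R m phi phi_proper phi_convex phiC2
  xbar r c L r0 c0
  (fun x xr => let: And3 AU _ _ := bounds x xr in AU.2)
  (fun x xr => let: And3 _ HL _ := bounds x xr in HL)
  lipH
  (fun x w xr => let: And3 _ _ Hc := bounds x xr in Hc w).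
set h := comp_grad_conjugate f phi.
set g := grad (conjugate phi) in gG gx *.
set J := fun u => invmx (hess phi (g u)) in gG *.
have hE u : V u -> h u = f (g u).
  by move=> Vu'; rewrite /h /comp_grad_conjugate mem_set//; exact: VU.
have fE x : W x -> f x = h (grad phi x).
  by case: gG => _ _ GW _ _ Wx; have [VG ggx] := GW _ Wx; rewrite hE// ggx.
have [[oV _] gV _ [C gC] _] := gG; have [Wx Gx JK] := gV _ Vu.
have hessE : hess (conjugate phi) (grad phi xbar) = J (grad phi xbar).
  exact: C11_jacobian oV Vu gC.
rewrite gx in Wx Gx JK.
have Ksym := hess_sym phiC2 Ux.
have JE : J (grad phi xbar) = invmx (hess phi xbar).
  exact (congr1 (fun x => invmx (hess phi x)) gx).
have Jsym : (J (grad phi xbar))^T = hess (conjugate phi) (grad phi xbar).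
  by rewrite hessE JE trmx_inv; exact (congr1 invmx Ksym).
split => [fprox|hprox].
  rewrite -Jsym; apply: (prox_regular_comp gG Vu hE).
  exact (eq_ind_r (fun x => prox_regular f x vbar) fprox gx).
have := prox_regular_comp (C11_diffeo_sym gG) Wx fE hprox.
have -> : vbar *m hess (conjugate phi) (grad phi xbar) *m (hess phi xbar)^T =
    vbar.
  by rewrite hessE -mulmxA (etrans (congr1 (mulmx _) Ksym) JK) mulmx1.
by [].
Qed.
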